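(* Let $\mathcal{A}$ be a unital complex Banach algebra with identity $\mathbf{1}$, let $a, b \in \mathcal{A}$ and let $\lambda \in \mathbb{C}$ be such that $\nu(a+b-\lambda\mathbf{1}) < |\lambda|$. Put $b_1 = b - \lambda\mathbf{1}$. Then for any integer $n \geq 1$, $$(a+b)^{-n} = \sum_{k=0}^{\infty} \binom{-n}{k} \lambda^{-n-k} (a+b_1)^{k} = \sum_{k=0}^{\infty} \sum_{j=0}^{k} \binom{-n}{k} \binom{k}{j} \lambda^{-n-k}\, \delta_{a+b_1,b_1}^{\,k-j}(\mathbf{1})\, b_1^{j}.$$
   Context: For $x \in \mathcal{A}$, the spectrum is $\mathfrak{S}(x) = \{\mu\in\mathbb{C} : \mu\mathbf{1}-x \text{ is not invertible in } \mathcal{A}\}$ and the spectral radius is $\nu(x) = \sup\{|\mu| : \mu\in\mathfrak{S}(x)\}$. For $n \geq 1$ and $k\ge 0$, $\binom{-n}{k} = \frac{(-n)(-n-1)\cdots(-n-k+1)}{k!} = \frac{(-1)^k n(n+1)\cdots(n+k-1)}{k!}$ (equal to $1$ for $k=0$). For $b_1,b_2\in\mathcal{A}$, the linear map $\delta_{b_1,b_2}:\mathcal{A}\to\mathcal{A}$ is defined by $\delta_{b_1,b_2}(x) = b_1x - xb_2$; $\delta_{b_1,b_2}^{\,m}$ is its $m$-fold composition, with $\delta_{b_1,b_2}^{\,0}$ the identity map. Zeroth powers of elements equal $\mathbf{1}$. $(a+b)^{-n}$ denotes the $n$-th power of the inverse of $a+b$ (whose invertibility is part of the assertion), and the infinite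 series over $k$ converge in the norm of $\mathcal{A}$. *)

(* Defs.v *)
From HB Require Import structures.
From mathcomp Require Import all_boot all_order all_algebra.
From mathcomp Require Import all_classical all_reals all_analysis.
From mathcomp Require Import complex.

Set Implicit Arguments.
Unset Strict Implicit.
Unset Printing Implicit Defensive.

Import Order.TTheory GRing.Theory Num.Theory.
Import numFieldNormedType.Exports.
Import ComplexField.Normc.

Local Open Scope classical_set_scope.
Local Open Scope ring_scope.

(* A plain record rather than an HB structure: HB refuses to join
   [NormedModule] with a ring structure, because [Num.NumDomain] already is
   the declared join of their ancestors and its norm is multiplicative.
   The normalization [`|1| = 1] is not imposed. *)
Record banachAlgType (K : numFieldType) := BanachAlg {
  ba_sort : completeNormedModType K;
  ba_one : ba_sort;
  ba_mul : ba_sort -> ba_sort -> ba_sort;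
  ba_mulA : associative ba_mul;
  ba_mul1l : left_id ba_one ba_mul;
  ba_mul1r : right_id ba_one ba_mul;
  ba_mulDl : left_distributive ba_mul +%R;
  ba_mulDr : right_distributive ba_mul +%R;
  ba_one_neq0 : ba_one != 0;
  ba_scaleAl : forall (c : K) (x y : ba_sort),
    c *: ba_mul x y = ba_mul (c *: x) y;
  ba_scaleAr : forall (c : K) (x y : ba_sort),
    c *: ba_mul x y = ba_mul x (c *: y);
  ba_normM : forall x y : ba_sort, `|ba_mul x y| <= `|x| * `|y| }.

Definition ba_carrier (K : numFieldType) (A : banachAlgType K) : Type :=
  ba_sort A.
Coercion ba_carrier : banachAlgType >-> Sortclass.

Section BanachAlgebraInstances.
Variables (K : numFieldType) (A : banachAlgType K).

HB.instance Definition _ := CompleteNormedModule.on (ba_carrier A).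

HB.instance Definition _ := GRing.Zmodule_isNzRing.Build (ba_carrier A)
  (@ba_mulA K A) (@ba_mul1l K A) (@ba_mul1r K A) (@ba_mulDl K A)
  (@ba_mulDr K A) (@ba_one_neq0 K A).

HB.instance Definition _ :=
  GRing.Lmodule_isLalgebra.Build K (ba_carrier A) (@ba_scaleAl K A).

HB.instance Definition _ :=
  GRing.Lalgebra_isAlgebra.Build K (ba_carrier A) (@ba_scaleAr K A).

Definition ba_inverses (x : A) : set A := [set y | y * x = 1 /\ x * y = 1].

Definition ba_unit : pred A := fun x => `[< ba_inverses x !=set0 >].

(* the inverse of [x], and [x] itself when [x] is not invertible *)
Definition ba_inv (x : A) : A := xget x (ba_inverses x).

Let ba_invP (x : A) : x \in ba_unit -> ba_inverses x (ba_inv x).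
Proof. by move=> /asboolP; exact: xgetPex. Qed.

Let ba_mulVr : {in ba_unit, left_inverse 1 ba_inv *%R}.
Proof. by move=> x /ba_invP[]. Qed.

Let ba_mulrV : {in ba_unit, right_inverse 1 ba_inv *%R}.
Proof. by move=> x /ba_invP[]. Qed.

Let ba_unitP (x y : A) : y * x = 1 /\ x * y = 1 -> ba_unit x.
Proof. by move=> xy; apply/asboolP; exists y. Qed.

Let ba_inv_out : {in [predC ba_unit], ba_inv =1 id}.
Proof.
by move=> x /asboolPn/forallNP xN; exact: xgetPN.
Qed.

HB.instance Definition _ := GRing.NzRing_hasMulInverse.Build (ba_carrier A)
  ba_mulVr ba_mulrV ba_unitP ba_inv_out.

End BanachAlgebraInstances.

Section Spectrum.
Variables (R : realType) (A : banachAlgType R[i]).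

Definition spectrum (x : A) : set R[i] :=
  [set mu | mu%:A - x \isn't a GRing.unit].

(* [normc mu] is the modulus of [mu] as an element of [R], whereas [`|mu|]
   lives in [R[i]]. The spectrum being nonempty and bounded, the default value
   0 of [sup] is never used. *)
Definition spectral_radius (x : A) : R := sup [set normc mu | mu in spectrum x].

End Spectrum.

Definition gbinomial (K : fieldType) (x : K) (k : nat) : K :=
  (\prod_(i < k) (x - i%:R)) / k`!%:R.

Definition delta (A : pzRingType) (b1 b2 : A) (x : A) : A := b1 * x - x * b2.

(* Main.v *)
(** The only analytic input is the bound [nu(x) < s -> (x / s)^k --> 0], for
    which we avoid complex integration, following Rickart's elementary proof of
    the spectral radius formula.  If [1 - z x] is invertible for [|z| <= 1], its
    inverse is bounded on the disc, hence Lipschitz in [z].  The averages of the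
    resolvent over the [2^m]-th roots of unity are [(1 - (z x)^(2^m))^-1], so
    these are Lipschitz in [z] with a constant independent of [m].  Moving [z]
    from 0 to 1 in small steps of fixed size, convergence of the powers of
    [z x] to 0 propagates from each step to the next.

    With [z := (a + b1) / lambda], Pascal's rule for [binom(-n, k)] gives
    [(1 + z) S_(n+1)(N) = S_n(N) + binom(-n-1, N) z^(N+1)] between partial sums,
    so the first expansion follows by induction on [n] from the decay of the
    terms.  The second is the binomial formula for left multiplication by
    [a + b1], which is the sum of the commuting maps [delta] and right
    multiplication by [b1]. *)
Require Import Defs.
From mathcomp Require Import all_boot all_order all_algebra.
From mathcomp Require Import all_classical all_reals all_analysis.
From mathcomp Require Import complex ring lra.

Import Order.TTheory GRing.Theory Num.Theory.
Import numFieldNormedType.Exports.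
Import ComplexField.Normc.

Local Open Scope classical_set_scope.
Local Open Scope ring_scope.

Set Implicit Arguments.
Unset Strict Implicit.
Unset Printing Implicit Defensive.

(** * Real-valued norm estimates and the Neumann series *)

Section RealNorm.
Variables (R : realType) (A : banachAlgType R[i]).
Implicit Types (x y z : A) (c : R[i]).

(* The library's norm [`|x|] takes values in [R[i]]. *)
Definition nrm x : R := complex.Re `|x|.

Lemma nrmE x : `|x| = (nrm x)%:C%C.
Proof. by rewrite /nrm RRe_real // normr_real. Qed.

Lemma normr_normc c : `|c| = (normc c)%:C%C.
Proof. by []. Qed.

Lemma nrm_ge0 x : 0 <= nrm x.
Proof. by rewrite -lecR -nrmE normr_ge0. Qed.

Lemma nrmD x y : nrm (x + y) <= nrm x + nrm y.
Proof. by rewrite -lecR rmorphD /= -!nrmE ler_normD. Qed.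

Lemma nrmN x : nrm (- x) = nrm x.
Proof. by rewrite /nrm normrN. Qed.

Lemma nrm_triangle y x z : nrm (x - z) <= nrm (x - y) + nrm (y - z).
Proof. by rewrite (le_trans _ (nrmD _ _))// addrA subrK. Qed.

Lemma nrmM x y : nrm (x * y) <= nrm x * nrm y.
Proof. by rewrite -lecR rmorphM /= -!nrmE; exact: ba_normM. Qed.

Lemma nrmZ c x : nrm (c *: x) = normc c * nrm x.
Proof.
apply/eqP; rewrite -(inj_eq (@complexI R)) rmorphM /= -!nrmE -normr_normc.
by rewrite normrZ.
Qed.

Lemma nrm0 : nrm (0 : A) = 0.
Proof. by rewrite /nrm normr0. Qed.

Lemma nrm_eq0 x : nrm x = 0 -> x = 0.
Proof. by move=> x0; apply: normr0_eq0; rewrite nrmE x0. Qed.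

(** The factor [nrm 1] covers [n = 0], since the norm of the identity may exceed 1. *)
Lemma nrmX x n : nrm (x ^+ n) <= nrm 1 * nrm x ^+ n.
Proof.
elim: n => [|n IHn]; first by rewrite !expr0 mulr1.
by rewrite !exprSr mulrA (le_trans (nrmM _ _))// ler_wpM2r// nrm_ge0.
Qed.

Lemma cvg_nrm (u : nat -> A) (l : A) :
  nrm (l - u n) @[n --> \oo] --> (0 : R) -> u @ \oo --> l.
Proof.
move=> /cvgrPdist_le ul; apply/cvgrPdist_le => e e0.
have eE : e = (complex.Re e)%:C%C by rewrite RRe_real// gtr0_real.
have : 0 < complex.Re e by move: e0; rewrite ltcE /= => /andP[].
move=> /ul; apply: filterS => n.
by rewrite sub0r normrN ger0_norm ?nrm_ge0// nrmE eE lecR.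
Qed.

Lemma nrm_cvg (u : nat -> A) (l : A) :
  u @ \oo --> l -> nrm (l - u n) @[n --> \oo] --> (0 : R).
Proof.
move=> /cvgrPdist_le ul; apply/cvgrPdist_le => e e0.
have : 0 < e%:C%C :> R[i] by rewrite ltcE /= eqxx.
move=> /ul; apply: filterS => n.
by rewrite sub0r normrN ger0_norm ?nrm_ge0// nrmE lecR.
Qed.

Lemma nrm_sum (I : Type) (r : seq I) (P : pred I) (F : I -> A) :
  nrm (\sum_(i <- r | P i) F i) <= \sum_(i <- r | P i) nrm (F i).
Proof.
elim/big_ind2: _ => [|x s y t xs yt|//]; first by rewrite nrm0.
by rewrite (le_trans (nrmD _ _))// lerD.
Qed.

(** Comparison test: the Cauchy criterion passes from [v] to [u], and [A] is complete. *)
Lemma is_cvg_series_nrm (u : nat -> A) (v : nat -> R) :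
  (forall n, nrm (u n) <= v n) -> cvg (series v @ \oo) -> cvg (series u @ \oo).
Proof.
move=> uv /cauchy_cvgP/cauchy_seriesP v_cauchy.
apply/cauchy_cvgP/cauchy_seriesP => e e0.
have eE : e = (complex.Re e)%:C%C by rewrite RRe_real// gtr0_real.
have : 0 < complex.Re e by move: e0; rewrite ltcE /= => /andP[].
move=> /v_cauchy; apply: filterS => n vn.
rewrite nrmE eE ltcE /= eqxx /=; apply: le_lt_trans vn.
apply: le_trans (ler_norm _); apply: le_trans (nrm_sum _ _ _) _.
exact: ler_sum.
Qed.

Lemma cvg_le0 (v w : nat -> R) : (forall n, 0 <= v n <= w n) ->
  w @ \oo --> (0 : R) -> v @ \oo --> (0 : R).
Proof.
move=> vw w0; apply: (@squeeze_cvgr _ _ _ _ (fun=> 0) w) => //.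
  exact: nearW.
exact: cvg_cst.
Qed.

Lemma cvg_eq0 (s : R) (w : nat -> R) : (forall n, 0 <= s <= w n) ->
  w @ \oo --> (0 : R) -> s = 0.
Proof.
move=> sw w0; have := cvg_le0 sw w0 => s0.
by rewrite -(cvg_lim (@Rhausdorff R) s0) lim_cst.
Qed.

(** The inverse is the Neumann series: its partial sums satisfy [s n * (1 - u) = 1 - u ^+ n] and
    commute with [1 - u]. *)
Lemma unit_1sub u : nrm u < 1 -> 1 - u \is a GRing.unit.
Proof.
move=> u1; pose s := series (fun n => u ^+ n).
have u1' : `|nrm u| < 1 by rewrite ger0_norm ?nrm_ge0.
have u0 : nrm 1 * nrm u ^+ n @[n --> \oo] --> (0 : R).
  exact: (@cvg_geometric _ (nrm 1)).
have /cvg_ex[l sl] : cvg (s @ \oo).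
  apply: (@is_cvg_series_nrm _ (geometric (nrm 1) (nrm u))).
    by move=> n; exact: nrmX.
  exact: is_cvg_geometric_series.
have {sl} sl := nrm_cvg sl.
have sE n : s n * (1 - u) = 1 - u ^+ n.
  rewrite /s /series /= big_mkord; elim: n => [|n IHn].
    by rewrite big_ord0 mul0r expr0 subrr.
  by rewrite big_ord_recr /= mulrDl IHn mulrBr mulr1 -exprSr addrA subrK.
have sC n : s n * (1 - u) = (1 - u) * s n.
  rewrite /s /series /= mulr_suml mulr_sumr; apply: eq_bigr => i _.
  by rewrite mulrBl mulrBr mul1r mulr1 -exprS -exprSr.
have bnd0 : nrm (1 - u) * nrm (l - s n) + nrm 1 * nrm u ^+ n
    @[n --> \oo] --> (0 : R).
  rewrite -[X in _ --> X](addr0 0) -[X in _ --> X + _](mulr0 (nrm (1 - u))).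
  by apply: cvgD => //; apply: cvgM => //; exact: cvg_cst.
apply/unitrP; exists l; split; apply/eqP; rewrite -subr_eq0; apply/eqP/nrm_eq0;
  apply: (cvg_eq0 _ bnd0) => n; rewrite nrm_ge0 /=.
- rewrite (_ : _ - 1 = (l - s n) * (1 - u) - u ^+ n); last first.
    by rewrite mulrBl sE -addrA -opprD subrK.
  rewrite (le_trans (nrmD _ _))// nrmN lerD ?nrmX//.
  by rewrite mulrC nrmM.
- rewrite (_ : _ - 1 = (1 - u) * (l - s n) - u ^+ n); last first.
    by rewrite mulrBr -sC sE -addrA -opprD subrK.
  by rewrite (le_trans (nrmD _ _))// nrmN lerD ?nrmX// nrmM.
Qed.

(** In [y^-1 = x^-1 + x^-1 (x - y) y^-1] the last term has norm at most half that of [y^-1], so it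
    can be absorbed. *)
Lemma nrm_inv_near x y : x \is a GRing.unit -> y \is a GRing.unit ->
  nrm x^-1 * nrm (x - y) <= 2^-1 -> nrm y^-1 <= 2 * nrm x^-1.
Proof.
move=> ux uy xy.
have yE : y^-1 = x^-1 + x^-1 * (x - y) * y^-1.
  by rewrite mulrBr mulrBl mulVr// mul1r mulrK// addrC subrK.
have : nrm y^-1 <= nrm x^-1 + 2^-1 * nrm y^-1.
  rewrite {1}yE (le_trans (nrmD _ _))// lerD2l (le_trans (nrmM _ _))//.
  by rewrite ler_wpM2r ?nrm_ge0// (le_trans (nrmM _ _)).
lra.
Qed.

End RealNorm.

(** * Boundedness on the closed unit disc by compactness *)

Section Disc.
Variable R : realType.

Lemma normc_ge0 (z : R[i]) : 0 <= normc z.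
Proof. by rewrite -lecR -normr_normc normr_ge0. Qed.

Lemma normcR (t : R) : normc t%:C%C = `|t|.
Proof. by rewrite /= expr0n/= addr0 sqrtr_sqr. Qed.

Lemma normcX (z : R[i]) n : normc (z ^+ n) = normc z ^+ n.
Proof. by elim: n => [|n IHn]; rewrite ?expr0 ?normc1// !exprS normcM IHn. Qed.

Lemma normc_le_ReIm (z : R[i]) :
  normc z <= `|complex.Re z| + `|complex.Im z|.
Proof.
case: z => s t /=; rewrite -(@ler_pXn2r _ 2)// ?nnegrE ?sqrtr_ge0 ?addr_ge0//.
rewrite sqr_sqrtr ?addr_ge0 ?sqr_ge0// sqrrD !real_normK ?num_real//.
by rewrite lerD2r lerDl mulrn_wge0 ?mulr_ge0.
Qed.

(** Relates the product topology of [R * R], where squares are known to be compact, to the modulus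
    on [R[i]]. *)
Lemma cvg_Complex (p : R * R) :
  normc (Complex p.1 p.2 - Complex q.1 q.2) @[q --> p] --> (0 : R).
Proof.
have h : `|p.1 - q.1| + `|p.2 - q.2| @[q --> p] --> (0 : R).
  have zE : 0 = `|p.1 - p.1| + `|p.2 - p.2| by rewrite !subrr normr0 addr0.
  rewrite [X in _ --> X]zE.
  apply: cvgD; apply: cvg_norm; apply: cvgB; try exact: cvg_cst.
  - exact: cvg_fst.
  - exact: cvg_snd.
apply: (@squeeze_cvgr _ _ _ _ (fun=> 0) _ _ _ _ _ h); last exact: cvg_cst.
by apply: nearW => q; rewrite normc_ge0 normc_le_ReIm.
Qed.

Lemma closed_disc_bounded (f : R[i] -> R) :
  (forall z, normc z <= 1 -> exists e M : R, 0 < e /\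
    forall w, normc w <= 1 -> normc (z - w) < e -> f w <= M) ->
  exists M, forall z, normc z <= 1 -> f z <= M.
Proof.
move=> f_bnd.
pose K : set (R * R) := `[-1, 1]%classic `*` `[-1, 1]%classic.
have /compact_near_coveringP K_cov : compact K.
  by apply: compact_setX; exact: segment_compact.
(* The bound is only claimed on the disc, so [P] can be checked near every point of the square
   [K]. *)
pose P (M : R) (p : R * R) :=
  normc (Complex p.1 p.2) <= 1 -> f (Complex p.1 p.2) <= M.
have K_bnd : \forall M \near +oo, K `<=` P M.
  apply: K_cov => p _.
  have p_cvg := @cvg_Complex p.
  have [p1|p1] := leP (normc (Complex p.1 p.2)) 1.
    have [e [M [e0 fM]]] := f_bnd _ p1.
    move/cvgrPdist_lt : p_cvg => /(_ e e0) p_e.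
    exists ([set q | normc (Complex p.1 p.2 - Complex q.1 q.2) < e],
            [set N | M <= N]).
      split => /=; last exact: nbhs_pinfty_ge (num_real M).
      by apply: filterS p_e => q /=; rewrite sub0r normrN ger0_norm ?normc_ge0.
    move=> [q N] /= [qe MN] q1; exact: le_trans (fM _ q1 qe) MN.
  (* Off the disc, the ball of radius [|p| - 1] around [p] misses the disc and [P] is vacuous
     there. *)
  move/cvgrPdist_lt : p_cvg => /(_ (normc (Complex p.1 p.2) - 1)).
  rewrite subr_gt0 => /(_ p1) p_e.
  exists ([set q | normc (Complex p.1 p.2 - Complex q.1 q.2) <
                   normc (Complex p.1 p.2) - 1], setT).
    split => /=; last exact: filterT.
    by apply: filterS p_e => q /=; rewrite sub0r normrN ger0_norm ?normc_ge0.
  move=> [q N] /= [qe _] q1; exfalso.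
  have := le_normcD (Complex p.1 p.2 - Complex q.1 q.2) (Complex q.1 q.2).
  rewrite subrK leNgt => /negP; apply.
  rewrite /= in qe q1 *; lra.
have [M [_ KM]] := K_bnd.
exists (M + 1) => -[s t] z1.
have [s1 t1] : `|s| <= 1 /\ `|t| <= 1.
  have le1 u : u ^+ 2 <= s ^+ 2 + t ^+ 2 -> `|u| <= 1.
    move=> ust; apply: le_trans z1; rewrite -sqrtr_sqr ler_wsqrtr//.
  by split; apply: le1; rewrite ?lerDl ?lerDr sqr_ge0.
have := KM (M + 1) _ (s, t); apply => //=; first by rewrite ltrDl.
by split; rewrite /= in_itv /= -ler_norml.
Qed.

End Disc.

(** * Decay of the powers of [x] when [1 - z x] is invertible on the disc *)

Section PowersToZero.
Variables (R : realType) (A : banachAlgType R[i]).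
Implicit Types (x y : A) (z w : R[i]).

Lemma mulrBVV x y : x \is a GRing.unit -> y \is a GRing.unit ->
  x^-1 - y^-1 = x^-1 * (y - x) * y^-1.
Proof.
by move=> ux uy; rewrite mulrBr mulrBl mulVr// mul1r mulrK.
Qed.

(** Write [n = (n %/ k) k + r] with [r < k]: the first part decays geometrically and [B] bounds the
    finitely many remainders. *)
Lemma cvg_nrmX x k : (0 < k)%N -> nrm (x ^+ k) < 1 ->
  nrm (x ^+ n) @[n --> \oo] --> (0 : R).
Proof.
move=> k0 xk1.
pose B := \sum_(r < k) nrm (x ^+ r).
have B_le r : (r < k)%N -> nrm (x ^+ r) <= B.
  move=> rk; rewrite /B (bigD1 (Ordinal rk))//= lerDl sumr_ge0// => i _.
  exact: nrm_ge0.
have xn_le n : nrm (x ^+ n) <= (nrm (1 : A) * nrm (x ^+ k) ^+ (n %/ k)) * B.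
  rewrite {1}(divn_eq n k) exprD mulnC exprM (le_trans (nrmM _ _))//.
  by apply: ler_pM; rewrite ?nrm_ge0 ?nrmX// B_le// ltn_mod.
apply: (cvg_le0 (w := fun n => (nrm (1 : A) * nrm (x ^+ k) ^+ (n %/ k)) * B)).
  by move=> n; rewrite nrm_ge0 xn_le.
rewrite -[X in _ --> X](mul0r B); apply: cvgM; last exact: cvg_cst.
have g0 : nrm (1 : A) * nrm (x ^+ k) ^+ m @[m --> \oo] --> (0 : R).
  by apply: (@cvg_geometric _ (nrm (1 : A))); rewrite ger0_norm ?nrm_ge0.
apply: (cvg_comp (fun n => (n %/ k)%N) _ _ g0).
move=> P [N _ NP]; exists (N * k)%N => // n /= Nn; apply: NP => /=.
by rewrite leq_divRL.
Qed.

Lemma complex_rootN1 n : (0 < n)%N ->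
  exists2 w : R[i], w ^+ n = - 1 & normc w = 1.
Proof.
move=> n0; exists (n.-root (- 1))%C; first by rewrite rootCK.
apply/eqP; rewrite -(pexpr_eq1 n0) ?normc_ge0// -normcX rootCK//.
by rewrite normcN normc1.
Qed.

Variable x : A.
Hypothesis x_unit : forall z, normc z <= 1 -> 1 - z *: x \is a GRing.unit.

Lemma resolvent_bounded :
  exists M, forall z, normc z <= 1 -> nrm (1 - z *: x)^-1 <= M.
Proof.
apply: closed_disc_bounded => z z1.
(* At distance below [C^-1] the perturbation [(w - z) x] meets the hypothesis of [nrm_inv_near]; the
   [+ 1] keeps [C] positive. *)
pose C := 2 * nrm (1 - z *: x)^-1 * nrm x + 1.
have C0 : 0 < C by rewrite ltr_wpDl// !mulr_ge0 ?nrm_ge0.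
exists C^-1, (2 * nrm (1 - z *: x)^-1); split; first by rewrite invr_gt0.
move=> w w1 zw; apply: nrm_inv_near; [exact: x_unit..|].
rewrite opprD opprK addrACA subrr add0r addrC -scalerBl nrmZ.
rewrite -normcN opprB.
have : normc (z - w) * C <= 1.
  by rewrite -ler_pdivlMr// div1r ltW.
rewrite /C; have := normc_ge0 (z - w); lra.
Qed.

(** The average of [(1 - w z x)^-1] over the roots of [w^(2^m) = 1], built up by the recursion
    [G_rec]. *)
Let G m z : A := (1 - (z *: x) ^+ (2 ^ m))^-1.

Lemma expX2_factor y m : 1 - y ^+ (2 ^ m.+1) =
  (1 - y ^+ (2 ^ m)) * (1 + y ^+ (2 ^ m)).
Proof.
rewrite mulrDr mulr1 mulrBl mul1r -exprD addnn -mul2n -expnS.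
by rewrite addrA subrK.
Qed.

(** Taking [zeta^(2^m) = -1] turns the factor [1 + y] of [1 - y^2] into a factor [1 - y] at a
    rotated point of the disc. *)
Lemma expX2_rot m : exists2 zeta : R[i], normc zeta = 1 &
  forall z, 1 + (z *: x) ^+ (2 ^ m) = 1 - ((zeta * z) *: x) ^+ (2 ^ m).
Proof.
have [w wm w1] := complex_rootN1 (expn_gt0 2 m).
exists w => // z; by rewrite -scalerA [in RHS]exprZn wm scaleN1r opprK.
Qed.

Lemma unit_1subX2 m z : normc z <= 1 ->
  1 - (z *: x) ^+ (2 ^ m) \is a GRing.unit.
Proof.
elim: m z => [|m IHm] z z1; first by rewrite expn0 expr1 x_unit.
have [zeta zeta1 zetaE] := expX2_rot m.
rewrite expX2_factor unitrMl; first exact: IHm.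
by rewrite zetaE IHm// normcM zeta1 mul1r.
Qed.

(* With [y := (z x)^(2^m)], this is
   [(1 - y^2)^-1 = ((1 - y)^-1 + (1 + y)^-1) / 2]. *)
Lemma G_rec m : exists2 zeta : R[i], normc zeta = 1 &
  forall z, normc z <= 1 -> G m.+1 z = 2^-1 *: (G m z + G m (zeta * z)).
Proof.
have [zeta zeta1 zetaE] := expX2_rot m; exists zeta => // z z1.
have u1 := unit_1subX2 m z1.
have u2 : 1 + (z *: x) ^+ (2 ^ m) \is a GRing.unit.
  by rewrite zetaE unit_1subX2// normcM zeta1 mul1r.
rewrite /G -zetaE expX2_factor.
set y := (z *: x) ^+ (2 ^ m) in u1 u2 *.
have y12 : (1 - y) * (1 + y) = (1 + y) * (1 - y).
  apply: commrD; first exact: commr1.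
  by apply: commr_sym; apply: commrB; first exact: commr1.
have -> : (1 - y)^-1 + (1 + y)^-1 = 2 *: ((1 - y) * (1 + y))^-1.
  apply: (mulrI u1); rewrite mulrDr divrr//.
  rewrite -scalerAr y12 invrM// mulVKr//.
  apply: (mulIr u2); rewrite mulrDl mul1r mulrVK// -scalerAl mulVr//.
  by rewrite addrACA subrr addr0 scaler_nat mulr2n.
by rewrite scalerA mulVf ?scale1r// pnatr_eq0.
Qed.

(** For [m = 0] this is the resolvent identity. A rotation preserves distances and a mean of two
    [C]-Lipschitz functions is [C]-Lipschitz, so [C] serves for all [m]. *)
Lemma G_lip : exists2 C, 0 < C & forall m z w, normc z <= 1 -> normc w <= 1 ->
  nrm (G m z - G m w) <= C * normc (z - w).
Proof.
have [M xM] := resolvent_bounded.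
have M0 : 0 <= M.
  by apply: le_trans (xM 0 _); rewrite ?nrm_ge0// normc0.
exists (M * nrm x * M + 1); first by rewrite ltr_wpDl// !mulr_ge0 ?nrm_ge0.
elim=> [|m IHm] z w z1 w1.
  rewrite /G !expn0 !expr1 mulrBVV ?x_unit//.
  rewrite opprD opprK addrACA subrr add0r addrC -scalerBl -scalerAr -scalerAl.
  rewrite nrmZ mulrC ler_wpM2r ?normc_ge0// -[leLHS]addr0 lerD//.
  rewrite (le_trans (nrmM _ _))// ler_pM ?nrm_ge0 ?xM//.
  by rewrite (le_trans (nrmM _ _))// ler_pM ?nrm_ge0 ?xM.
have [zeta zeta1 GE] := G_rec m.
have rot1 v : normc v <= 1 -> normc (zeta * v) <= 1.
  by rewrite normcM zeta1 mul1r.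
rewrite !GE// -scalerBr nrmZ opprD addrACA.
have -> : normc 2^-1 = 2^-1 :> R.
  by rewrite normcV -(rmorph_nat (real_complex R) 2) normcR ger0_norm.
have h1 := IHm z w z1 w1.
have h2 := IHm _ _ (rot1 z z1) (rot1 w w1).
rewrite -mulrBr normcM zeta1 mul1r in h2.
have := nrmD (G m z - G m w) (G m (zeta * z) - G m (zeta * w)).
lra.
Qed.

(** From [d = y + y d] with [|y| <= 1/9], [|d| <= (1/9) / (1 - 1/9) = 1/8]. *)
Lemma nrm_resolvent_sub1 y : 1 - y \is a GRing.unit -> nrm y <= 9^-1 ->
  nrm ((1 - y)^-1 - 1) <= 8^-1.
Proof.
move=> uy y9; set d := (1 - y)^-1 - 1.
have dE : d = y + y * d.
  have dK : 1 + d = (1 - y)^-1 by rewrite [LHS]addrC subrK.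
  transitivity (y * (1 + d)); last by rewrite mulrDr mulr1.
  rewrite dK /d.
  apply: (mulIr uy); rewrite mulrBl mulrVK// mul1r mulVr//.
  by rewrite opprB addrC subrK.
have : nrm d <= nrm y + nrm y * nrm d.
  by rewrite {1}dE (le_trans (nrmD _ _))// lerD2l nrmM.
have := ler_wpM2r (nrm_ge0 d) y9; lra.
Qed.

(** From [y = d - d y] with [|d| <= 1/4], [|y| <= 1/3]. *)
Lemma nrm_le_resolvent_sub1 y : 1 - y \is a GRing.unit ->
  nrm ((1 - y)^-1 - 1) <= 4^-1 -> nrm y < 1.
Proof.
move=> uy; set d := (1 - y)^-1 - 1 => d4.
have yE : y = d - d * y.
  transitivity (d * (1 - y)); last by rewrite mulrBr mulr1.
  rewrite /d mulrBl mulVr// mul1r.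
  by rewrite opprB addrC subrK.
have : nrm y <= nrm d + nrm d * nrm y.
  by rewrite {1}yE (le_trans (nrmD _ _))// lerD2l nrmN nrmM.
have := ler_wpM2r (nrm_ge0 y) d4; lra.
Qed.

Lemma cvg_nrmX_unit : nrm (x ^+ n) @[n --> \oo] --> (0 : R).
Proof.
have [C C0 C_lip] := G_lip.
(* One step of length [1/N] changes each [G m] by at most 1/8; added to the 1/8 of
   [nrm_resolvent_sub1] this gives the 1/4 of [nrm_le_resolvent_sub1]. *)
pose N := (Num.truncn (8 * C)).+1.
have CN : C / N%:R <= 8^-1.
  rewrite ler_pdivrMr ?ltr0n// -ler_pdivrMl ?invr_gt0// invrK.
  by rewrite ltW// truncnS_gt.
pose t k : R[i] := (k%:R / N%:R)%:C%C.
have t1 k : (k <= N)%N -> normc (t k) <= 1.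
  move=> kN; rewrite normcR ger0_norm ?divr_ge0//.
  by rewrite ler_pdivrMr ?ltr0n// mul1r ler_nat.
suff t_cvg k : (k <= N)%N -> nrm ((t k *: x) ^+ n) @[n --> \oo] --> (0 : R).
  have tN : t N *: x = x by rewrite /t divff ?pnatr_eq0// scale1r.
  by have := t_cvg N (leqnn N); rewrite tN.
elim: k => [|k IHk] kN.
  apply: (@cvg_nrmX _ 1) => //.
  by rewrite /t mul0r scale0r expr1 nrm0.
have /cvgrPdist_le/(_ 9^-1)[|m _ xm] := IHk (ltnW kN).
  by rewrite invr_gt0.
apply: (@cvg_nrmX _ (2 ^ m)); first exact: expn_gt0.
apply: nrm_le_resolvent_sub1; first exact: unit_1subX2 (t1 _ kN).
have km9 : nrm ((t k *: x) ^+ (2 ^ m)) <= 9^-1.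
  have := xm (2 ^ m)%N; rewrite sub0r normrN ger0_norm ?nrm_ge0//.
  (* The exponent [2 ^ m] exceeds [m], the threshold beyond which the powers are small. *)
  by apply; rewrite /= ltnW// ltn_expl.
have km8 := nrm_resolvent_sub1 (unit_1subX2 m (t1 _ (ltnW kN))) km9.
have := C_lip m _ _ (t1 _ kN) (t1 _ (ltnW kN)).
have -> : normc (t k.+1 - t k) = N%:R^-1.
  rewrite /t -rmorphB -mulrBl -natrB// subSnn mul1r normcR ger0_norm//.
have := nrm_triangle (G m (t k)) (G m (t k.+1)) 1.
rewrite /G; lra.
Qed.

End PowersToZero.

(** * Binomial coefficients and the binomial formula for [delta] *)

Section Binomial.

(** Upper negation. The truncated predecessor also gives the right values at [n = 0], the base case
    of the later induction. *)
Lemma gbinomialN (K : numFieldType) n k :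
  gbinomial (- n%:R : K) k = (- 1) ^+ k * 'C((n + k).-1, k)%:R.
Proof.
rewrite /gbinomial.
have -> : \prod_(i < k) (- n%:R - i%:R) =
    (- 1) ^+ k * ((n + k).-1 ^_ k)%:R :> K.
  elim: k => [|k IHk]; first by rewrite big_ord0 ffactn0 expr0 mulr1.
  rewrite big_ord_recr /= IHk addnS /= ffactnS natrM natrD exprS; ring.
by rewrite -bin_ffact natrM mulrA mulfK// pnatr_eq0 -lt0n fact_gt0.
Qed.

Lemma gbinomialN_pascal (K : numFieldType) n k :
  gbinomial (- n.+1%:R : K) k.+1 + gbinomial (- n.+1%:R) k =
  gbinomial (- n%:R) k.+1.
Proof.
by rewrite !gbinomialN !addSn !addnS /= binS natrD exprS; ring.
Qed.

Lemma gbinomial0 (K : fieldType) (t : K) : gbinomial t 0 = 1.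
Proof. by rewrite /gbinomial big_ord0 fact0 divr1. Qed.

Lemma gbinomialN0S (K : numFieldType) k : gbinomial (- 0%:R : K) k.+1 = 0.
Proof. by rewrite gbinomialN /= bin_small// mulr0. Qed.

(* One term of the expansion of [(q + (1 - q)) ^+ (n + k) = 1]. *)
Lemma bin_geometric_le (R : realFieldType) (q : R) n k : 0 <= q -> q < 1 ->
  'C(n + k, k)%:R * q ^+ k <= (1 - q) ^- n.
Proof.
move=> q0 q1; have q1' : 0 < 1 - q by rewrite subr_gt0.
rewrite -[leRHS]mul1r ler_pdivlMr ?exprn_gt0//.
rewrite -[leRHS](expr1n _ (n + k)) -[X in _ <= X ^+ _](subrK q 1).
rewrite [leRHS]exprDn (bigD1 (Ordinal (leq_addl n k : (k < (n + k).+1)%N)))//=.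
rewrite addnK mulr_natl mulrnAl mulrC lerDl sumr_ge0// => i _.
by rewrite mulrn_wge0// mulr_ge0// exprn_ge0// ltW.
Qed.

(** Multiplying a term by [c] on the left raises either the power of [delta c d] or that of [d] by
    one; Pascal's rule then regroups the terms. *)
Lemma delta_binomial (K : fieldType) (A : algType K) (c d : A) k :
  \sum_(j < k.+1) 'C(k, j)%:R *: (iter (k - j) (delta c d) 1 * d ^+ j) = c ^+ k.
Proof.
elim: k => [|k IHk].
  by rewrite big_ord_recl big_ord0 /= addr0 bin0 scale1r mulr1.
have deltaE y : c * y = delta c d y + y * d by rewrite /delta subrK.
rewrite exprS -{}IHk mulr_sumr.
have step (j : nat) m : c * ('C(k, j)%:R *: (iter m (delta c d) 1 * d ^+ j)) =
    'C(k, j)%:R *: (iter m.+1 (delta c d) 1 * d ^+ j) +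
    'C(k, j)%:R *: (iter m (delta c d) 1 * d ^+ j.+1).
  by rewrite -scalerAr mulrA deltaE mulrDl -mulrA -exprS scalerDr.
rewrite (eq_bigr _ (fun j _ => step _ _)).
rewrite big_split /= [in LHS]big_ord_recl bin0 scale1r subn0 mulr1.
rewrite [X in _ = X + _]big_ord_recl bin0 scale1r subn0 mulr1 -[RHS]addrA.
congr (_ + _).
under [LHS]eq_bigr => j _ do
  rewrite lift0 binS natrD scalerDl subSS.
rewrite big_split /= [X in X + _ = _]big_ord_recr /= bin_small// scale0r addr0.
by congr (_ + _); apply: eq_bigr => j _;
  rewrite /bump leq0n add1n -iterS -subSn.
Qed.

End Binomial.

(** * Binomial series in [A] and its convergence under the spectral radius bound *)

Section BinomialSeries.
Variables (R : realType) (A : banachAlgType R[i]).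
Implicit Types (x z : A).

Lemma binomial_partial_sum z n N :
  (1 + z) * \sum_(k < N.+1) gbinomial (- n.+1%:R) k *: z ^+ k =
  \sum_(k < N.+1) gbinomial (- n%:R) k *: z ^+ k +
  gbinomial (- n.+1%:R) N *: z ^+ N.+1.
Proof.
elim: N => [|N IHN].
  by rewrite !big_ord_recl !big_ord0 /= !gbinomial0 !addr0 !scale1r mulr1.
rewrite big_ord_recr /= mulrDr IHN [in RHS]big_ord_recr /=.
rewrite -[in RHS]gbinomialN_pascal scalerDl mulrDl mul1r -scalerAr -exprS.
by rewrite -!addrA; congr (_ + _); rewrite addrCA.
Qed.

Lemma cvg_binomial_series z : 1 + z \is a GRing.unit ->
  (forall n, nrm (gbinomial (- n%:R) k *: z ^+ k) @[k --> \oo] --> (0 : R)) ->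
  forall n, series (fun k => gbinomial (- n%:R) k *: z ^+ k) @ \oo
    --> (1 + z)^-1 ^+ n.
Proof.
move=> uz z0; elim=> [|n IHn].
  (* The empty partial sum is 0; from one term on, the sum for [n = 0] is exactly 1, hence the
     shift. *)
  apply/cvg_nrm; rewrite -cvg_shiftS /series /=.
  rewrite (_ : (fun N => _) = fun=> 0); first exact: cvg_cst.
  apply/funext => N; rewrite big_mkord big_ord_recl gbinomial0 scale1r expr0.
  rewrite big1 ?addr0 ?subrr ?nrm0// => i _.
  by rewrite gbinomialN0S scale0r.
apply/cvg_nrm; rewrite -cvg_shiftS /=.
move/nrm_cvg : IHn; rewrite -cvg_shiftS /= => IHn.
apply: (cvg_le0 (w := fun N => nrm (1 + z)^-1 *
  (nrm ((1 + z)^-1 ^+ n -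
        series (fun k => gbinomial (- n%:R) k *: z ^+ k) N.+1) +
   nrm (gbinomial (- n.+1%:R) N *: z ^+ N) * nrm z))).
  move=> N; rewrite nrm_ge0 /=.
  set S := series _ N.+1; set T := series _ N.+1.
  (* Up to the factor [(1 + z)^-1], the error at [n + 1] is the error at [n] minus the top term of
     [binomial_partial_sum]. *)
  have -> : (1 + z)^-1 ^+ n.+1 - S =
      (1 + z)^-1 * ((1 + z)^-1 ^+ n - (1 + z) * S).
    by rewrite mulrBr mulKr// exprS.
  rewrite (le_trans (nrmM _ _))// ler_wpM2l ?nrm_ge0//.
  rewrite /S /series /= big_mkord binomial_partial_sum.
  rewrite opprD addrA (le_trans (nrmD _ _))// nrmN lerD//.
    by rewrite /T /series /= big_mkord.
  by rewrite exprSr scalerAl nrmM.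
rewrite -[X in _ --> X](mulr0 (nrm (1 + z)^-1)).
apply: cvgM; first exact: cvg_cst.
rewrite -[X in _ --> X](addr0 0); apply: cvgD => //.
by rewrite -[X in _ --> X](mul0r (nrm z)); apply: cvgM;
  [exact: z0|exact: cvg_cst].
Qed.

(** If [|mu| > |x|], then [mu - x = mu (1 - x / mu)] is invertible by the Neumann series. *)
Lemma spectrum_le_nrm x mu : spectrum x mu -> normc mu <= nrm x.
Proof.
apply: contraPP => /negP; rewrite -ltNge => x_mu; rewrite /spectrum /=.
have mu0 : mu != 0.
  by apply: contraTneq x_mu => ->; rewrite normc0 -leNgt nrm_ge0.
apply/negP; rewrite negbK.
have -> : mu%:A - x = mu *: (1 - mu^-1 *: x).
  by rewrite scalerBr scalerA divff// scale1r.
rewrite scaler_unit ?unitfE//; apply: unit_1sub.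
rewrite nrmZ normcV mulrC ltr_pdivrMr ?mul1r//.
exact: le_lt_trans (nrm_ge0 _) x_mu.
Qed.

Lemma ubound_spectrum x : has_ubound [set normc mu | mu in spectrum x].
Proof. by exists (nrm x) => _ [mu xmu <-]; exact: spectrum_le_nrm. Qed.

Lemma spectral_radius_ge0 x : 0 <= spectral_radius x.
Proof.
have [[_ [mu xmu _]]|E0] := pselect ([set normc mu | mu in spectrum x] !=set0).
  apply: le_trans (normc_ge0 mu) _.
  by apply: ub_le_sup; [exact: ubound_spectrum|exists mu].
(* On the empty set [sup] takes the value 0, which settles this case too. *)
by rewrite /spectral_radius sup_out// => -[].
Qed.

Lemma unit_spectral_radius x mu : spectral_radius x < normc mu ->
  mu%:A - x \is a GRing.unit.
Proof.
move=> xmu; apply/negPn/negP => muS; move: xmu; rewrite ltNge => /negP; apply.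
by apply: ub_le_sup; [exact: ubound_spectrum|exists mu].
Qed.

(** For [0 < |z| <= 1], [1 - z x / s = (z / s) (s / z - x)] is invertible because [|s / z| >= s]
    exceeds the spectral radius. *)
Lemma cvg_nrm_spectral_radius x (s : R) : spectral_radius x < s ->
  nrm ((s%:C%C^-1 *: x) ^+ n) @[n --> \oo] --> (0 : R).
Proof.
move=> xs; have s0 : 0 < s by apply: le_lt_trans xs; exact: spectral_radius_ge0.
have sC0 : s%:C%C != 0 :> R[i] by rewrite fmorph_eq0 gt_eqF.
apply: cvg_nrmX_unit => z z1; have [->|z0] := eqVneq z 0.
  by rewrite scale0r subr0 unitr1.
have -> : 1 - z *: (s%:C%C^-1 *: x) = (z / s%:C%C) *: ((s%:C%C / z)%:A - x).
  by rewrite scalerBr !scalerA mulrA divfK// divff// scale1r.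
rewrite scaler_unit ?unitfE ?mulf_neq0 ?invr_eq0//.
apply: unit_spectral_radius; apply: lt_le_trans xs _.
rewrite normcM normcV normcR gtr0_norm// ler_pdivlMr ?ler_piMr// ?ltW//.
by rewrite lt_neqAle normc_ge0 eq_sym andbT;
  apply: contra z0 => /eqP/eq0_normc->.
Qed.

Lemma cvg_gbinomial_powers x (lambda : R[i]) n :
  spectral_radius x < normc lambda ->
  nrm (gbinomial (- n%:R) k *: (lambda^-1 *: x) ^+ k) @[k --> \oo] --> (0 : R).
Proof.
move=> x_lambda; have r0 := spectral_radius_ge0 x.
(* With [s] strictly between, [(x / s)^k] still tends to 0, while [q = s / |lambda| < 1] keeps
   [binom(-n, k) q^k] bounded. *)
pose s : R := (spectral_radius x + normc lambda) / 2.
have xs : spectral_radius x < s by rewrite /s; lra.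
have s_lambda : s < normc lambda by rewrite /s; lra.
have s0 : 0 < s := le_lt_trans r0 xs.
have lambda0 : 0 < normc lambda := lt_trans s0 s_lambda.
have sC0 : s%:C%C != 0 :> R[i] by rewrite fmorph_eq0 gt_eqF.
pose q := s / normc lambda.
have q0 : 0 <= q by rewrite divr_ge0// ltW.
have q1 : q < 1 by rewrite ltr_pdivrMr// mul1r.
have qE : normc (lambda^-1 * s%:C%C) = q.
  by rewrite normcM normcV normcR gtr0_norm// mulrC.
have -> : lambda^-1 *: x = (lambda^-1 * s%:C%C) *: (s%:C%C^-1 *: x).
  by rewrite scalerA mulfK.
apply: (cvg_le0 (w := fun k => (1 - q) ^- n * nrm ((s%:C%C^-1 *: x) ^+ k))).
  move=> k; rewrite nrm_ge0 /= exprZn !nrmZ mulrA ler_wpM2r ?nrm_ge0//.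
  rewrite normcX qE; apply: le_trans (bin_geometric_le n k q0 q1).
  rewrite ler_wpM2r ?exprn_ge0// gbinomialN.
  rewrite normcM normcX normcN normc1 expr1n mul1r.
  rewrite -(rmorph_nat (real_complex R)) normcR ger0_norm//.
  by rewrite ler_nat leq_bin2l// leq_pred.
rewrite -[X in _ --> X](mulr0 ((1 - q) ^- n)).
by apply: cvgM; [exact: cvg_cst|exact: cvg_nrm_spectral_radius].
Qed.

End BinomialSeries.

(** * The two expansions of [(a + b)^-1 ^+ n] *)

Theorem mainTheorem4 (R : realType) (A : banachAlgType R[i]) (a b : A)
    (lambda : R[i])
    (hlambda : spectral_radius (a + b - lambda%:A) < normc lambda)
    (n : nat) (hn : (1 <= n)%N) :
  let b1 := b - lambda%:A in
  [/\ a + b \is a GRing.unit,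
      series (fun k : nat =>
        (gbinomial (- n%:R) k * lambda ^- (n + k)) *: (a + b1) ^+ k) @ \oo
        --> (a + b)^-1 ^+ n
    & series (fun k : nat => \sum_(j < k.+1)
        (gbinomial (- n%:R) k * 'C(k, j)%:R * lambda ^- (n + k)) *:
          (iter (k - j) (delta (a + b1) b1) 1 * b1 ^+ j)) @ \oo
        --> (a + b)^-1 ^+ n].
Proof.
move=> b1; pose x := a + b1.
have xE : a + b - lambda%:A = x by rewrite -addrA.
rewrite {}xE in hlambda.
have lambda0 : lambda != 0.
  apply: contraTneq hlambda => ->.
  by rewrite normc0 -leNgt spectral_radius_ge0.
have lambdaU : lambda \is a GRing.unit by rewrite unitfE.
have abE : a + b = lambda *: (1 + lambda^-1 *: x).
  by rewrite scalerDr scalerA divff// scale1r /x /b1 addrCA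
    [lambda%:A + _]addrC subrK.
have abU : a + b \is a GRing.unit.
  (* [- lambda] has the modulus of [lambda], so it lies outside the spectrum of [x], and
     [- lambda - x = - (a + b)]. *)
  rewrite -unitrN; have := @unit_spectral_radius _ _ x (- lambda).
  rewrite normcN => /(_ hlambda).
  rewrite (_ : _ - x = - (a + b))//.
  by rewrite /x /b1 addrA opprB scaleNr addrA addNr add0r.
have zU : 1 + lambda^-1 *: x \is a GRing.unit.
  by rewrite abE scaler_unit in abU.
have cvg1 : series (fun k : nat =>
    (gbinomial (- n%:R) k * lambda ^- (n + k)) *: x ^+ k) @ \oo
    --> (a + b)^-1 ^+ n.
  rewrite abE invrZ// exprZn.
  rewrite (_ : series _ = fun N => lambda^-1 ^+ n *:
    series (fun k => gbinomial (- n%:R) k *: (lambda^-1 *: x) ^+ k) N);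
    last first.
    apply/funext => N; rewrite /series /= scaler_sumr; apply: eq_bigr => k _.
    by rewrite exprZn !scalerA exprVn exprVn exprD invfM mulrCA !mulrA.
  apply: cvgZl_tmp.
  apply: cvg_binomial_series => // m; exact: cvg_gbinomial_powers.
split=> //.
rewrite (_ : (fun k => _) = fun k : nat =>
    (gbinomial (- n%:R) k * lambda ^- (n + k)) *: x ^+ k)//.
apply/funext => k; rewrite -(@delta_binomial _ _ x b1) scaler_sumr.
by apply: eq_bigr => j _; rewrite scalerA mulrAC.
Qed.
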